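(* Let $D=\mathbb T^d$, $T>0$, $\tau>0$. Assume that a space- and time-continuous solution $(\rho,\vec J)$ on $D\times[0,T]$ of the system $$\frac{\partial\rho}{\partial t}=-\nabla\cdot\vec J,$$ $$\varphi_\tau(\rho)\frac{\partial\vec J}{\partial t}=-\gamma\vec J-k_BT\,\nabla\rho-\nabla\mathcal V\,\rho^++\sigma\frac1{\sqrt N}\sqrt{\rho\,\varphi_\tau(\rho)}\;\vec\xi_\epsilon$$ with $\rho(\cdot,0)=\rho_0$ exists, and that $(\rho,\vec J)$ is twice differentiable in space and once differentiable in time in the region $\{(x,t):\rho(x,t)<0\}$. Then, provided that $\rho_0>0$, $$\inf_{x\in D,\ t\in[0,T]}\rho(x,t)\ge 0 .$$
   Context: $\mathbb T^d=(\mathbb R/2\pi\mathbb Z)^d$, $d\ge1$. $\gamma>0$, $\sigma\in\mathbb R$, $k_BT:=\sigma^2/(2\gamma)>0$ (here $k_BT$ is a single symbol for this number, unrelated to the final time $T$), $N\in\mathbb N$, $\epsilon>0$; $\mathcal V:D\to\mathbb R$ is a potential; $\rho^+:=\max\{\rho,0\}$. $\varphi_\tau:\mathbb R\to[0,1]$ is a smooth monotone function equal to $0$ on $(-\infty,\tau/2)$ and equal to $1$ on $(\tau,\infty)$. $\vec\xi_\epsilon$ is an $\mathbb R^d$-valued Gaussian noise with independent, mean-zero components which are white in time and correlated in space, with spatial covariance kernel of von Mises type, proportional to $\exp\{-\sum_{\ell=1}^d\sin^2((x_\ell-y_\ell)/2)/(\epsilon^2/2)\}$. The statement is for a realisation of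 the solution; in the region $\{\rho<0\}$, where the coefficients $\varphi_\tau(\rho)$, $\rho^+$ and $\sqrt{\rho\,\varphi_\tau(\rho)}$ vanish, the equations are satisfied in the classical pointwise sense. *)

(* Defs.v *)
From HB Require Import structures.
From mathcomp Require Import all_boot all_order all_algebra.
From mathcomp Require Import all_classical all_reals all_analysis.
Set Implicit Arguments.
Unset Strict Implicit.
Unset Printing Implicit Defensive.
Import Order.TTheory GRing.Theory Num.Theory.
Import numFieldNormedType.Exports.
Local Open Scope classical_set_scope.
Local Open Scope ring_scope.

(* Functions on the torus (R / 2 pi Z)^d are functions on R^d = 'rV[R]_d that
   are 2 pi-periodic in each coordinate. *)
Definition torus_periodic (R : realType) (d : nat) (Y : Type)
    (f : 'rV[R]_d -> Y) : Prop :=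
  forall (x : 'rV[R]_d) (l : 'I_d), f (x + (2 * pi) *: delta_mx 0 l) = f x.

(* Iterated integral over the fundamental cell [0, 2 pi]^d. *)
Fixpoint torus_int (R : realType) (d : nat) : ('rV[R]_d -> R) -> R :=
  match d with
  | 0 => fun f => f 0
  | n.+1 => fun f =>
      \int[lebesgue_measure]_(a in `[0, 2 * pi])
        torus_int (fun y : 'rV[R]_n => f (row_mx (a%:M : 'rV[R]_1) y))
  end.

Definition partial (R : realType) (d : nat) (V : normedModType R) (l : 'I_d)
    (f : 'rV[R]_d -> V) (x : 'rV[R]_d) : V := 'D_(delta_mx 0 l) f x.

Definition grad (R : realType) (d : nat) (f : 'rV[R]_d -> R) (x : 'rV[R]_d) :
  'rV[R]_d := \row_l partial l f x.

Definition divergence (R : realType) (d : nat) (u : 'rV[R]_d -> 'rV[R]_d)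
    (x : 'rV[R]_d) : R := \sum_(l < d) partial l (fun y => u y 0 l) x.

Definition time_deriv (R : realType) (V : normedModType R) (f : R -> V)
    (t : R) : V := 'D_1 f t.

Definition smooth_test (R : realType) (d : nat) (psi : 'rV[R]_d -> R) : Prop :=
  torus_periodic psi /\
  forall (s : seq 'I_d) (x : 'rV[R]_d),
    differentiable (foldr (fun l f => partial l f) psi s) x.

Definition pos_part (R : realType) (r : R) : R := Num.max r 0.

Record is_cutoff (R : realType) (tau : R) (phi : R -> R) : Prop := {
  cutoff_smooth : forall (n : nat) (r : R), derivable (derive1n n phi) r 1;
  cutoff_monotone : forall r s : R, r <= s -> phi r <= phi s;
  cutoff_range : forall r : R, 0 <= phi r <= 1;
  cutoff_eq0 : forall r : R, r < tau / 2 -> phi r = 0;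
  cutoff_eq1 : forall r : R, tau < r -> phi r = 1 }.

Definition kBT (R : realType) (gamma sigma : R) : R :=
  sigma ^+ 2 / (2 * gamma).

Definition noise_coef (R : realType) (sigma : R) (N : nat) (phi : R -> R)
    (r : R) : R := sigma / Num.sqrt N%:R * Num.sqrt (r * phi r).

Definition von_mises (R : realType) (d : nat) (eps c : R) (x y : 'rV[R]_d) :
    R :=
  c * expR (- \sum_(l < d) sin ((x 0 l - y 0 l) / 2) ^+ 2 / (eps ^+ 2 / 2)).

Definition is_filtration d0 (Omega : measurableType d0) (R : realType)
    (F : R -> set (set Omega)) : Prop :=
  (forall t : R, sigma_algebra [set: Omega] (F t)) /\
  (forall t : R, F t `<=` measurable) /\
  (forall s t : R, s <= t -> F s `<=` F t).

Definition independent_systems d0 (Omega : measurableType d0) (R : realType)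
    (P : probability Omega R) (G H : set (set Omega)) : Prop :=
  forall A B : set Omega, G A -> H B -> P (A `&` B) = (P A * P B)%E.

(* normal_prob is the normal law only when its standard deviation is nonzero. *)
Definition centered_gaussian d0 (Omega : measurableType d0) (R : realType)
    (P : probability Omega R) (X : Omega -> R) (v : R) : Prop :=
  if v == 0 then {ae P, forall w, X w = 0}
  else forall A : set R, measurable A ->
         P (X @^-1` A) = normal_prob 0 (Num.sqrt v) A.

(* The noise xi_eps is the formal time derivative of W: white in time and
   correlated in space means that W is a centered Gaussian field with
   E[W_k(x,s) W_l(y,t)] = delta_kl * min(s,t) * K(x,y), K the von Mises kernel.
   The increments are independent of the past F, which may be larger than the
   filtration generated by W. *)
Record is_noise d0 (Omega : measurableType d0) (R : realType)
    (P : probability Omega R) (d : nat) (eps c : R)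
    (F : R -> set (set Omega)) (W : Omega -> 'I_d -> 'rV[R]_d -> R -> R) :
    Prop := {
  noise_periodic : forall (w : Omega) (l : 'I_d) (t : R),
    torus_periodic (fun x => W w l x t);
  noise_continuous : forall (w : Omega) (l : 'I_d),
    {within [set: 'rV[R]_d] `*` `[0, +oo[,
      continuous (fun z : 'rV[R]_d * R => W w l z.1 z.2)};
  noise_adapted : forall (l : 'I_d) (x : 'rV[R]_d) (t : R), 0 <= t ->
    forall B : set R, measurable B -> F t ((fun w => W w l x t) @^-1` B);
  noise_gaussian : forall (n : nat) (a : 'I_n -> R) (l : 'I_n -> 'I_d)
      (x : 'I_n -> 'rV[R]_d) (t : 'I_n -> R), (forall i, 0 <= t i) ->
    centered_gaussian P (fun w => \sum_(i < n) a i * W w (l i) (x i) (t i))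
      (\sum_(i < n) \sum_(j < n)
         a i * a j * ((l i == l j)%:R * Num.min (t i) (t j)
                      * von_mises eps c (x i) (x j)));
  noise_indep_incr : forall s : R, 0 <= s ->
    independent_systems P (F s)
      <<s [set A | exists (l : 'I_d) (x : 'rV[R]_d) (t : R) (B : set R),
             [/\ s <= t, measurable B &
                 A = (fun w => W w l x t - W w l x s) @^-1` B]] >> }.

(* [stoch_integral P A X t Y]: the random variable Y is
   int_D int_0^t A(x,s) dX(x,s) dx in the Ito sense, that is the limit in
   probability of the left-endpoint sums over uniform subdivisions of [0,t]. *)
Definition stoch_sum (Omega : Type) (R : realType) (d : nat)
    (A X : Omega -> 'rV[R]_d -> R -> R) (t : R) (n : nat) (w : Omega) : R :=
  \sum_(i < n.+1)
    torus_int (fun x => A w x (t * i%:R / n.+1%:R) *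
      (X w x (t * i.+1%:R / n.+1%:R) - X w x (t * i%:R / n.+1%:R))).

Definition stoch_integral d0 (Omega : measurableType d0) (R : realType)
    (P : probability Omega R) (d : nat)
    (A X : Omega -> 'rV[R]_d -> R -> R) (t : R) (Y : Omega -> R) : Prop :=
  forall e : R, 0 < e ->
    P [set w | e <= `|stoch_sum A X t n w - Y w|] @[n --> \oo] --> 0%E.

(* A space- and time-continuous pair need not be differentiable, so the system
   is tested against smooth functions of x and integrated over [0,t]; in the
   momentum equation both phi(rho) dJ and the noise term are Ito integrals. *)
Record is_solution d0 (Omega : measurableType d0) (R : realType)
    (P : probability Omega R) (d : nat) (T gamma sigma : R) (N : nat)
    (V : 'rV[R]_d -> R) (phi : R -> R) (F : R -> set (set Omega))
    (W : Omega -> 'I_d -> 'rV[R]_d -> R -> R)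
    (rho0 : Omega -> 'rV[R]_d -> R)
    (rho : Omega -> 'rV[R]_d -> R -> R)
    (J : Omega -> 'rV[R]_d -> R -> 'rV[R]_d) : Prop := {
  sol_periodic_rho : forall (w : Omega) (t : R), 0 <= t <= T ->
    torus_periodic (fun x => rho w x t);
  sol_periodic_J : forall (w : Omega) (t : R), 0 <= t <= T ->
    torus_periodic (fun x => J w x t);
  sol_continuous_rho : forall w : Omega,
    {within [set: 'rV[R]_d] `*` `[0, T],
      continuous (fun z : 'rV[R]_d * R => rho w z.1 z.2)};
  sol_continuous_J : forall w : Omega,
    {within [set: 'rV[R]_d] `*` `[0, T],
      continuous (fun z : 'rV[R]_d * R => J w z.1 z.2)};
  sol_adapted_rho : forall (x : 'rV[R]_d) (t : R), 0 <= t <= T ->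
    forall B : set R, measurable B -> F t ((fun w => rho w x t) @^-1` B);
  sol_adapted_J : forall (l : 'I_d) (x : 'rV[R]_d) (t : R), 0 <= t <= T ->
    forall B : set R, measurable B -> F t ((fun w => J w x t 0 l) @^-1` B);
  sol_initial : forall (w : Omega) (x : 'rV[R]_d), rho w x 0 = rho0 w x;
  sol_continuity_eq : forall psi : 'rV[R]_d -> R, smooth_test psi ->
    forall t : R, 0 <= t <= T ->
    {ae P, forall w,
      torus_int (fun x => rho w x t * psi x) =
      torus_int (fun x => rho0 w x * psi x) +
      \int[lebesgue_measure]_(s in `[0, t])
        torus_int (fun x => \sum_(l < d) J w x s 0 l * partial l psi x)};
  sol_momentum_eq : forall (psi : 'rV[R]_d -> R), smooth_test psi ->
    forall (l : 'I_d) (t : R), 0 <= t <= T ->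
    exists I M : Omega -> R,
    [/\ stoch_integral P (fun w x s => psi x * phi (rho w x s))
          (fun w x s => J w x s 0 l) t I,
        stoch_integral P (fun w x s => psi x * noise_coef sigma N phi (rho w x s))
          (fun w x s => W w l x s) t M &
        {ae P, forall w, I w =
          \int[lebesgue_measure]_(s in `[0, t])
            torus_int (fun x =>
              - gamma * J w x s 0 l * psi x
              + kBT gamma sigma * rho w x s * partial l psi x
              - partial l V x * pos_part (rho w x s) * psi x)
          + M w}] }.

(* Only interior times, where two-sided time derivatives make sense. *)
Definition in_negative_region (R : realType) (d : nat) (T : R)
    (rho : 'rV[R]_d -> R -> R) (x : 'rV[R]_d) (t : R) : Prop :=
  0 < t < T /\ rho x t < 0.

Definition negative_region_regular (R : realType) (d : nat) (T : R)
    (rho : 'rV[R]_d -> R -> R) (J : 'rV[R]_d -> R -> 'rV[R]_d) : Prop :=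
  forall (x : 'rV[R]_d) (t : R), in_negative_region T rho x t ->
  [/\ differentiable (fun y => rho y t) x /\ differentiable (fun y => J y t) x,
      forall l : 'I_d, differentiable (partial l (fun y => rho y t)) x,
      forall l : 'I_d, differentiable (partial l (fun y => J y t)) x,
      derivable (rho x) t 1 &
      derivable (J x) t 1].

(* z stands for the value of the noise, which has no pointwise meaning; the
   noise coefficient vanishes wherever rho < 0, so z is immaterial there. *)
Definition negative_region_classical (R : realType) (d : nat)
    (T gamma sigma : R) (N : nat) (V : 'rV[R]_d -> R) (phi : R -> R)
    (rho : 'rV[R]_d -> R -> R) (J : 'rV[R]_d -> R -> 'rV[R]_d) : Prop :=
  forall (x : 'rV[R]_d) (t : R), in_negative_region T rho x t ->
  time_deriv (rho x) t = - divergence (fun y => J y t) x /\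
  exists z : 'rV[R]_d,
    phi (rho x t) *: time_deriv (J x) t =
      - gamma *: J x t - kBT gamma sigma *: grad (fun y => rho y t) x
      - pos_part (rho x t) *: grad V x + noise_coef sigma N phi (rho x t) *: z.

(* Main.v *)
Require Import Defs.
From HB Require Import structures.
From mathcomp Require Import all_boot all_order all_algebra.
From mathcomp Require Import all_classical all_reals all_analysis.
From mathcomp Require Import ring lra.
Set Implicit Arguments.
Unset Strict Implicit.
Unset Printing Implicit Defensive.
Import Order.TTheory GRing.Theory Num.Theory.
Import numFieldNormedType.Exports.
Local Open Scope classical_set_scope.
Local Open Scope ring_scope.

(** The inertia, the potential force and the noise are all switched off where
    rho < 0: there phi_tau(rho), rho^+ and
    sqrt(rho phi_tau(rho)) vanish, and the momentum equation degenerates to the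
    Darcy-type law gamma J = - k_BT grad rho. Substituted into the continuity
    equation, it makes rho a classical solution of the heat equation
    rho_t = (k_BT / gamma) Laplacian rho in the open set where rho is negative
    ([negative_region_heat]).

    The heat equation cannot create a negative minimum
    ([heat_weak_minimum_principle]). If rho were negative somewhere at an
    interior time t, a small tilt v = rho + delta * time with delta > 0 would
    still be negative there, and v would have a minimum over the torus times
    [0, t], which is compact. That minimum is negative, so it is attained at
    a point of the negative region, and not at time 0. Being minimal over
    earlier times forces rho_t <= - delta < 0; being minimal in space forces
    all pure second derivatives, hence the Laplacian, to be nonnegative
    ([second_directional_derivative_ge0_at_min]). This contradicts the heat
    equation. No boundary intervenes since the torus has none. *)

(** * The fundamental cell of the torus *)

Lemma torus_periodic_lattice (R : realType) (d : nat) (Y : Type)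
    (f : 'rV[R]_d -> Y) (k : 'I_d -> int) (x : 'rV[R]_d) :
  torus_periodic f ->
  f (x + \sum_l (2 * pi * (k l)%:~R) *: delta_mx 0 l) = f x.
Proof.
move=> fper; move: x.
(* The periods of f form an additive group, generated here by the 2 pi e_l. *)
pose period (z : 'rV[R]_d) := forall x, f (x + z) = f x.
have period0 : period 0 by move=> x; rewrite addr0.
have periodD z1 z2 : period z1 -> period z2 -> period (z1 + z2).
  by move=> p1 p2 x; rewrite addrA p2 p1.
have periodN z : period z -> period (- z).
  by move=> pz x; rewrite -{2}[x](subrK z) pz.
apply: (big_ind period) => // l _.
have periodMn n : period ((2 * pi * n%:R) *: delta_mx 0 l).
  elim: n => [|n IHn]; first by rewrite mulr0 scale0r.
  rewrite -[n.+1]addn1 natrD mulrDr scalerDl mulr1.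
  apply: periodD; first exact: IHn.
  by move=> x; exact: fper.
case: (k l) => n; first exact: periodMn.
by rewrite NegzE mulrNz mulrN scaleNr; apply: periodN; exact: periodMn.
Qed.

Definition torus_cell (R : realType) (d : nat) : set 'rV[R]_d :=
  [set y | forall l, `[0, 2 * pi]%classic (y 0 l)].
Arguments torus_cell : clear implicits.

(** Reduction to a compact set: minimising a periodic function over the cell
    minimises it over the whole space. The representative does not depend on
    the function, so it serves every time slice simultaneously. *)
Lemma torus_cell_repr (R : realType) (d : nat) (x : 'rV[R]_d) :
  exists2 y, torus_cell R d y &
    forall (Y : Type) (f : 'rV[R]_d -> Y), torus_periodic f -> f y = f x.
Proof.
have pi2_gt0 : 0 < 2 * pi :> R by rewrite mulr_gt0 ?pi_gt0.
pose k l := - Num.floor (x 0 l / (2 * pi)).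
exists (x + \sum_l (2 * pi * (k l)%:~R) *: delta_mx 0 l); last first.
  by move=> Y f; exact: torus_periodic_lattice.
move=> l /=; rewrite mxE summxE (bigD1 l)//= big1 => [|i il]; last first.
  by rewrite !mxE [l == i]eq_sym (negbTE il) andbF mulr0.
rewrite !mxE !eqxx/= mulr1 addr0 /k mulrNz mulrN.
have /andP[] := floor_itv (x 0 l / (2 * pi)).
rewrite ler_pdivlMr// ltr_pdivrMr// intrD mulrDl mul1r mulrC => lo hi.
by rewrite in_itv/=; apply/andP; split; lra.
Qed.

(** * Derivatives at a minimum *)

Lemma secant_line (R : realType) (V : normedModType R) (f : V -> R)
    (a v : V) (t : R) :
  (fun h : R => h^-1 *: (((fun h : R => f (h *: v + a)) \o shift t) (h *: 1)
                         - f (t *: v + a))) =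
  (fun h : R => h^-1 *: ((f \o shift (t *: v + a)) (h *: v)
                         - f (t *: v + a))).
Proof. by apply/funext => h /=; rewrite scaler1 scalerDl addrA. Qed.

Lemma derivable_line (R : realType) (V : normedModType R) (f : V -> R)
    (a v : V) (t : R) :
  derivable (fun h : R => f (h *: v + a)) t 1 = derivable f (t *: v + a) v.
Proof. by rewrite /derivable secant_line. Qed.

Lemma derive_line (R : realType) (V : normedModType R) (f : V -> R)
    (a v : V) (t : R) :
  'D_1 (fun h : R => f (h *: v + a)) t = 'D_v f (t *: v + a).
Proof. by rewrite /derive secant_line. Qed.

Lemma cvg_secant (R : realType) (f : R -> R) (a : R) : derivable f a 1 ->
  h^-1 * (f (h + a) - f a) @[h --> 0^'] --> 'D_1 f a.
Proof.
move=> df; apply: cvg_trans df; apply: near_eq_cvg; apply: nearW => h /=.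
by rewrite scaler1.
Qed.

(** Were g'' negative at a, then g', which vanishes at the minimum a, would be
    negative just to the right of a, and g would decrease below g a. *)
Lemma second_derivative_ge0_at_min (R : realType) (g : R -> R) (a : R) :
  (\forall t \near a, derivable g t 1) -> derivable (derive1 g) a 1 ->
  (\forall t \near a, g a <= g t) -> 0 <= 'D_1 (derive1 g) a.
Proof.
move=> dg ddg gmin; rewrite leNgt; apply/negP => D2.
have [r /= r0 Hr] : exists2 r : R, 0 < r &
    forall t, t \in `](a - r), (a + r)[ -> derivable g t 1 /\ g a <= g t.
  have : \forall t \near a, derivable g t 1 /\ g a <= g t.
    by near=> t; split; near: t.
  case=> r /= r0 Hr; exists r => // t; rewrite in_itv/= => tr; apply: Hr => /=.
  by rewrite distrC ltr_distl.
have g'a0 : derive1 g a = 0.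
  rewrite derive1E; apply: derive_val.
  apply: (@derive1_at_min _ g (a - r) (a + r)); first by lra.
  - by move=> t /Hr[].
  - by rewrite in_itv/=; apply/andP; split; lra.
  - by move=> t /Hr[].
have [s [s0 sr g's]] : exists s : R, [/\ 0 < s, s < r &
    forall h, 0 < h <= s -> derive1 g (h + a) < 0].
  have /= [s /= s0 Hs] := cvgr_lt _ (cvg_secant ddg) _ D2.
  have m0 : 0 < Num.min s r by rewrite lt_min s0.
  exists (Num.min s r / 2); split; first by rewrite divr_gt0.
    have : Num.min s r <= r by rewrite ge_min lexx orbT.
    by lra.
  move=> h /andP[h0 hs].
  have : h^-1 * (derive1 g (h + a) - derive1 g a) < 0.
    apply: Hs; last by rewrite gt_eqF.
    rewrite /ball_/= sub0r normrN gtr0_norm//.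
    have : Num.min s r <= s by rewrite ge_min lexx.
    by lra.
  by rewrite g'a0 subr0 pmulr_rlt0// invr_gt0.
have : g (a + s) < g a.
  apply: (@ltr0_derive1_decr _ g a (a + s)) => //; last by lra.
  - move=> t; rewrite in_itv/= => /andP[? ?].
    by apply: (Hr t _).1; rewrite in_itv/=; apply/andP; split; lra.
  - move=> t; rewrite in_itv/= => /andP[? ?]; rewrite -(subrK a t).
    by apply: g's; apply/andP; split; lra.
  - apply: derivable_within_continuous => t; rewrite in_itv/= => /andP[? ?].
    by apply: (Hr t _).1; rewrite in_itv/=; apply/andP; split; lra.
rewrite ltNge => /negP; apply.
by apply: (Hr _ _).2; rewrite in_itv/=; apply/andP; split; lra.
Unshelve. all: by end_near. Qed.

(** The one-variable test, read along the line through a with direction v. *)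
Lemma second_directional_derivative_ge0_at_min (R : realType)
    (V : normedModType R) (f : V -> R) (a v : V) :
  (\forall y \near a, derivable f y v) -> derivable (fun y => 'D_v f y) a v ->
  (\forall y \near a, f a <= f y) -> 0 <= 'D_v (fun y => 'D_v f y) a.
Proof.
move=> df ddf fmin; pose g (h : R) := f (h *: v + a).
have g'E : derive1 g = (fun h : R => 'D_v f (h *: v + a)).
  by apply/funext => h; rewrite derive1E derive_line.
have line0 : (0 : R) *: v + a = a by rewrite scale0r add0r.
have line_cvg : h *: v + a @[h --> (0 : R)] --> a.
  rewrite -[X in _ --> X]line0; apply: cvgD; last exact: cvg_cst.
  by apply: cvgZr_tmp; exact: cvg_id.
have : 0 <= 'D_1 (derive1 g) 0; last first.
  by rewrite g'E (derive_line (fun y => 'D_v f y)) line0.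
apply: second_derivative_ge0_at_min.
- have : \forall h \near (0 : R), derivable f (h *: v + a) v := line_cvg _ df.
  by apply: filterS => h; rewrite derivable_line.
- by rewrite g'E (derivable_line (fun y => 'D_v f y)) line0.
- have : \forall h \near (0 : R), f a <= f (h *: v + a) := line_cvg _ fmin.
  by apply: filterS => h; rewrite /g line0.
Qed.

(** * Heat flow where the density is negative *)

(** Supersolutions of the heat equation that start nonnegative stay
    nonnegative. The differential inequality is assumed only where r < 0,
    because a negative minimum of r, tilted upwards in time, lies there. *)
Lemma heat_weak_minimum_principle (R : realType) (d : nat) (kappa T : R)
    (r : 'rV[R]_d -> R -> R) : 0 <= kappa ->
  (forall t, 0 <= t <= T -> torus_periodic (r^~ t)) ->
  {within [set: 'rV[R]_d] `*` `[0, T],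
    continuous (fun z : 'rV[R]_d * R => r z.1 z.2)} ->
  (forall x, 0 <= r x 0) ->
  (forall x t, in_negative_region T r x t ->
    [/\ differentiable (r^~ t) x,
        forall l, differentiable (partial l (r^~ t)) x,
        derivable (r x) t 1 &
        kappa * \sum_l partial l (partial l (r^~ t)) x <= time_deriv (r x) t]) ->
  forall x t, 0 <= t <= T -> 0 <= r x t.
Proof.
move=> kappa0 rper rcont r0 heat.
(* Two-sided time derivatives exist for t < T only; t = T follows by
   continuity. *)
suff interior x t : 0 < t < T -> 0 <= r x t.
  move=> x t /andP[t0 tT]; have [->//|tn0] := eqVneq t 0.
  rewrite leNgt; apply/negP => rneg.
  have conv : r z.1 z.2 @[z -->
      within ([set: 'rV[R]_d] `*` `[0, T]) (nbhs (x, t))] --> r x t.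
    move/subspace_continuousP : rcont => /(_ (x, t)); apply.
    by split => //=; rewrite in_itv/= t0.
  have := cvgr_lt _ conv _ rneg.
  move=> [[A B] /= [/nbhs_singleton Ax [e /= e0 Be]] AB].
  have m0 : 0 < Num.min e t by rewrite lt_min e0 lt_neqAle eq_sym tn0.
  have me : Num.min e t <= e by rewrite ge_min lexx.
  have mt : Num.min e t <= t by rewrite ge_min lexx orbT.
  pose s := t - Num.min e t / 2.
  have : 0 <= r x s by apply: interior; rewrite /s; apply/andP; split; lra.
  rewrite leNgt => /negP; apply; apply: (AB (x, s)).
    split => //; apply: Be => /=.
    by rewrite /s opprB addrC subrK gtr0_norm; lra.
  by split => //=; rewrite in_itv/= /s; apply/andP; split; lra.
move=> /andP[t0 tT]; rewrite leNgt; apply/negP => rneg.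
(* With this slope the tilt raises r x t to exactly half of its value. *)
pose delta := - r x t / (2 * t).
have delta0 : 0 < delta by rewrite divr_gt0 ?oppr_gt0// mulr_gt0.
pose v (z : 'rV[R]_d * R) := r z.1 z.2 + delta * z.2.
pose K := torus_cell R d `*` `[0, t].
have [y ycell yE] := torus_cell_repr x.
have Kcpt : compact K.
  apply: compact_setX; last exact: segment_compact.
  apply: (@rV_compact _ d (fun=> `[0, 2 * pi]%classic)) => l.
  exact: segment_compact.
have vcont : {within K, continuous v}.
  apply: within_continuousD.
    apply: continuous_subspaceW rcont => -[z s] [_ /=].
    by rewrite !in_itv/= => /andP[s0 st]; split => //=; apply/andP; split; lra.
  apply: continuous_subspaceT => z.
  by apply: cvgM; [exact: cvg_cst|exact: cvg_snd].
have [|[x1 t1] /set_mem[x1cell] + vmin] := compact_EVT_min _ Kcpt vcont.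
  by exists (y, t); split => //=; rewrite in_itv/= lexx ltW.
rewrite /= in_itv/= => /andP[t10 t1t].
have t1T : 0 <= t1 <= T by lra.
have vmin' z s : 0 <= s <= t -> v (x1, t1) <= v (z, s).
  move=> sI; have [z' z'cell z'E] := torus_cell_repr z.
  have -> : v (z, s) = v (z', s).
    by rewrite /v/= (z'E _ (r^~ s))//; apply: rper; lra.
  by apply: vmin; apply/mem_set; split => //=; rewrite in_itv/=.
have vneg : v (x1, t1) < 0.
  apply: le_lt_trans (vmin' x t _) _; first by rewrite lexx ltW.
  rewrite /v/= /delta.
  have -> : r x t + - r x t / (2 * t) * t = r x t / 2 by field; rewrite gt_eqF.
  lra.
have t1n0 : t1 != 0.
  apply/eqP => t1E; move: vneg; rewrite t1E /v/= mulr0 addr0.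
  by rewrite ltNge r0.
have t1gt0 : 0 < t1 by rewrite lt_neqAle eq_sym t1n0.
have r1neg : r x1 t1 < 0.
  by have := mulr_gt0 delta0 t1gt0; move: vneg; rewrite /v/= => ? ?; lra.
have t1lt : 0 < t1 < T by lra.
have [dr ddr drt rE] := heat x1 t1 (conj t1lt r1neg).
have lap0 : 0 <= \sum_l partial l (partial l (r^~ t1)) x1.
  apply: sumr_ge0 => l _; apply: second_directional_derivative_ge0_at_min.
  - have : \forall z \near x1, r z t1 < 0.
      exact: (cvgr_lt _ (differentiable_continuous dr) _ r1neg).
    apply: filterS => z zneg; apply: diff_derivable.
    by have [] := heat z t1 (conj t1lt zneg).
  - exact: (diff_derivable (ddr l)).
  - have x1min z : r x1 t1 <= r z t1.
      have := vmin' z t1; rewrite t10 t1t => /(_ isT).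
      by rewrite /v/= lerD2r.
    by near=> z; exact: x1min.
(* The heat inequality bounds the time derivative below by 0, whereas
   minimality of v over earlier times bounds it above by - delta. *)
have Dt0 : - delta < 'D_1 (r x1) t1.
  apply: lt_le_trans rE.
  by have := mulr_ge0 kappa0 lap0; lra.
have /= [s /= s0 Hs] := cvgr_gt _ (cvg_secant drt) _ Dt0.
have m0 : 0 < Num.min s t1 by rewrite lt_min s0.
have ms : Num.min s t1 <= s by rewrite ge_min lexx.
have mt : Num.min s t1 <= t1 by rewrite ge_min lexx orbT.
pose h := - (Num.min s t1 / 2).
have h0 : h < 0 by rewrite /h; lra.
have hs : - delta < h^-1 * (r x1 (h + t1) - r x1 t1).
  apply: Hs; last by rewrite lt_eqF.
  by rewrite /ball_/= sub0r normrN ltr0_norm// /h; lra.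
have := vmin' x1 (h + t1).
have -> : 0 <= h + t1 <= t by rewrite /h; lra.
move=> /(_ isT); rewrite /v/=.
move: hs; rewrite mulrC ltr_ndivlMr//. lra.
Unshelve. all: by end_near. Qed.

(** Every nonlinear coefficient vanishes at a negative density, since the
    cutoff is zero below tau / 2 > 0; only friction and diffusion remain. *)
Lemma negative_region_darcy (R : realType) (d : nat)
    (T gamma sigma tau : R) (N : nat) (V : 'rV[R]_d -> R) (phi : R -> R)
    (rho : 'rV[R]_d -> R -> R) (J : 'rV[R]_d -> R -> 'rV[R]_d) :
  0 < gamma -> 0 < tau -> is_cutoff tau phi ->
  negative_region_classical T gamma sigma N V phi rho J ->
  forall x t, in_negative_region T rho x t ->
  J x t = - (kBT gamma sigma / gamma) *: grad (rho^~ t) x.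
Proof.
move=> gamma0 tau0 hphi hcls x t xtneg.
have [_ [z]] := hcls x t xtneg; have rneg := xtneg.2.
have phi0 : phi (rho x t) = 0.
  by apply: (cutoff_eq0 hphi); have := divr_gt0 tau0 (ltr0n R 2); lra.
have pos0 : pos_part (rho x t) = 0 by apply: max_r; exact: ltW.
have noise0 : noise_coef sigma N phi (rho x t) = 0.
  by rewrite /noise_coef phi0 mulr0 sqrtr0 mulr0.
rewrite phi0 pos0 noise0 !scale0r subr0 addr0 => balance.
apply/rowP => l; move/rowP: balance => /(_ l); rewrite !mxE => balance.
apply: (mulfI (lt0r_neq0 gamma0)).
rewrite mulrA mulrN mulrCA mulfV ?lt0r_neq0// mulr1; lra.
Qed.

(** The Darcy law may be differentiated because it holds on a whole
    neighbourhood: negativity of rho is an open condition. *)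
Lemma negative_region_heat (R : realType) (d : nat)
    (T gamma sigma tau : R) (N : nat) (V : 'rV[R]_d -> R) (phi : R -> R)
    (rho : 'rV[R]_d -> R -> R) (J : 'rV[R]_d -> R -> 'rV[R]_d) :
  0 < gamma -> 0 < tau -> is_cutoff tau phi ->
  negative_region_regular T rho J ->
  negative_region_classical T gamma sigma N V phi rho J ->
  forall x t, in_negative_region T rho x t ->
  time_deriv (rho x) t =
    kBT gamma sigma / gamma * \sum_l partial l (partial l (rho^~ t)) x.
Proof.
move=> gamma0 tau0 hphi hreg hcls x t xtneg.
have [[drho _] ddrho _ _ _] := hreg x t xtneg.
have [-> _] := hcls x t xtneg.
rewrite /divergence -sumrN mulr_sumr; apply: eq_bigr => l _.
set kappa := kBT gamma sigma / gamma.
have fluxE : \forall y \near x,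
    J y t 0 l = (- kappa) *: partial l (rho^~ t) y.
  have : \forall y \near x, rho y t < 0.
    exact: (cvgr_lt _ (differentiable_continuous drho) _ xtneg.2).
  apply: filterS => y yneg.
  have ytneg := conj xtneg.1 yneg.
  by rewrite (negative_region_darcy gamma0 tau0 hphi hcls ytneg) !mxE.
rewrite {1}/partial (near_eq_derive _ fluxE) deriveZ; last first.
  exact: (diff_derivable (ddrho l)).
by rewrite scaleNr opprK.
Qed.

Theorem proposition7p1 (R : realType) (d : nat) (hd : (0 < d)%N)
  (gamma sigma : R) (hgamma : 0 < gamma) (hkBT : 0 < kBT gamma sigma)
  (N : nat) (hN : (0 < N)%N)
  (V : 'rV[R]_d -> R) (hVper : torus_periodic V)
  (hV : forall x : 'rV[R]_d, differentiable V x)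
  (T tau : R) (hT : 0 < T) (htau : 0 < tau)
  (phi : R -> R) (hphi : is_cutoff tau phi)
  (d0 : measure_display) (Omega : measurableType d0) (P : probability Omega R)
  (F : R -> set (set Omega)) (hF : is_filtration F)
  (eps c : R) (heps : 0 < eps) (hc : 0 < c)
  (W : Omega -> 'I_d -> 'rV[R]_d -> R -> R) (hW : is_noise P eps c F W)
  (rho0 : Omega -> 'rV[R]_d -> R)
  (rho : Omega -> 'rV[R]_d -> R -> R)
  (J : Omega -> 'rV[R]_d -> R -> 'rV[R]_d)
  (hsol : is_solution P T gamma sigma N V phi F W rho0 rho J)
  (w : Omega)
  (hreg : negative_region_regular T (rho w) (J w))
  (hcls : negative_region_classical T gamma sigma N V phi (rho w) (J w))
  (hrho0 : forall x : 'rV[R]_d, 0 < rho0 w x) :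
  (0 <= ereal_inf [set (rho w z.1 z.2)%:E
                    | z in ([set: 'rV[R]_d] `*` `[0, T])%R])%E.
Proof.
have kappa0 : 0 <= kBT gamma sigma / gamma by rewrite ltW// divr_gt0.
have rho_ge0 : forall x t, 0 <= t <= T -> 0 <= rho w x t.
  apply: (heat_weak_minimum_principle kappa0).
  - exact: sol_periodic_rho hsol w.
  - exact: sol_continuous_rho hsol w.
  - by move=> x; rewrite (sol_initial hsol); exact: ltW.
  - move=> x t xtneg; have [[drho _] ddrho _ dt _] := hreg x t xtneg.
    split => //.
    by rewrite (negative_region_heat hgamma htau hphi hreg hcls xtneg).
apply: le_ereal_inf_tmp => _ [[x t] [_ /=]] + <-.
by rewrite in_itv/= lee_fin => /rho_ge0.
Qed.
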